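(* Let $(y_n)_{n\ge1}$ be nonnegative and nonincreasing with $y_n\to0$, put $\lambda_M=y_M-y_{M+1}$ for $M\ge1$, and fix an integer $J_0\ge1$ such that $\lambda_M=0$ for $M<J_0$. Define $$L_k=\sum_{M=2^kJ_0}^{2^{k+1}J_0-1}\lambda_M\qquad(k\ge0).$$ Suppose that the indices $k$ with $L_k\ne0$ can be listed (as a finite or infinite list) as $k_1<k_2<\cdots$ with $$k_{j+1}-k_j\ge120,$$ and assume $E_3=\sum_ny_n^2<\infty$. For $x_n=n^{-3/2}y_n$, one has $$AE_3-\frac12\mathcal C(x)\ge\frac{\sqrt{J_0}}{125}\sum_{j\ge1}2^{k_j/2}L_{k_j}^3.$$ Consequently $\mathcal C(x)<2AE_3$ unless $y=0$. (Infinitely many nonzero $L_k$ are permitted, and no comparison between their values is imposed.)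
   Context: For a nonnegative sequence $x=(x_n)_{n\ge1}$, $$A=\sum_{n\ge1}x_n,\qquad E_3=\sum_{n\ge1}n^3x_n^2,\qquad \mathcal C(x)=\sum_{a,b\ge1}(a+b)(a^2+ab+b^2)x_ax_bx_{a+b}.$$ *)

(* Defs.v *)
From mathcomp Require Import all_boot all_order all_algebra.
From mathcomp Require Import all_classical all_reals all_analysis.
Import Order.TTheory GRing.Theory Num.Theory.
Import numFieldNormedType.Exports.

Set Implicit Arguments.
Unset Strict Implicit.
Unset Printing Implicit Defensive.

Local Open Scope classical_set_scope.
Local Open Scope ring_scope.

(* Sequences (x_n)_{n >= 1} are functions on nat whose value at 0 is never
   used.  Sums of nonnegative terms take values in the extended reals, so that
   divergence is +oo rather than an unspecified real number. *)

Definition sumA (R : realType) (x : R^nat) : \bar R :=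
  (\sum_(1 <= n <oo) (x n)%:E)%E.

Definition E3 (R : realType) (x : R^nat) : \bar R :=
  (\sum_(1 <= n <oo) (n%:R ^+ 3 * x n ^+ 2)%:E)%E.

Definition cubicC (R : realType) (x : R^nat) : \bar R :=
  (\esum_(p in [set p : nat * nat | (1 <= p.1)%N /\ (1 <= p.2)%N])
     ((p.1 + p.2)%:R * (p.1 ^ 2 + p.1 * p.2 + p.2 ^ 2)%:R
        * x p.1 * x p.2 * x (p.1 + p.2)%N)%:E)%E.

Definition decrement (R : realType) (y : R^nat) (M : nat) : R :=
  y M - y M.+1.

Definition blockL (R : realType) (y : R^nat) (J0 k : nat) : R :=
  \sum_(2 ^ k * J0 <= M < 2 ^ k.+1 * J0) decrement y M.

(* Positions j = 1, 2, ... of a list of length N; None is an infinite list. *)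
Definition positions (N : option nat) : set nat :=
  [set j | (1 <= j)%N /\ (if N is Some n then (j <= n)%N else True)].

(* k_1 < k_2 < ... is a list, of length N, of all the elements of S. *)
Definition lists_increasingly (N : option nat) (k : nat -> nat)
    (S : set nat) : Prop :=
  (forall j, positions N j -> positions N j.+1 -> (k j < k j.+1)%N) /\
  k @` positions N = S.

(* Main.v *)
Require Import Defs.
From mathcomp Require Import finmap.
From mathcomp Require Import all_boot all_order all_algebra.
From mathcomp Require Import all_classical all_reals all_analysis.
From mathcomp Require Import ring lra zify.
Import Order.TTheory GRing.Theory Num.Theory.
Import numFieldNormedType.Exports.
Local Open Scope classical_set_scope.
Local Open Scope ring_scope.

(** In terms of y, the summand of C is K(a,b) y_a y_b y_(a+b), where K blows up
    like a^(-3/2) + b^(-3/2) near the axes.  The proof compares K with these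
    two singular terms, which reproduce the product A E, and controls the rest.

    The kernel bound.  With s = a + b,
      K(a,b) <= a^(-3/2) + b^(-3/2) + ((a^(-1/2) + b^(-1/2))/2 - s^(-1/2))/s
    ([kernel_le]).  The two singular terms contribute
      sum_a a^(-3/2) y_a sum_b y_b y_(a+b)
    to C/2, and since 2 y_b (y_b - y_(a+b)) is the square of y_b - y_(a+b) plus
    y_b^2 - y_(a+b)^2, which telescopes in b, the difference from A E is
      1/2 sum_a a^(-3/2) y_a (sum_b (y_b - y_(a+b))^2 + sum_(b<=a) y_b^2).
    The first sum of squares is the gain.  The second one pays for the third
    term of the kernel bound: on a slice a + b = s, with y_a y_b replaced by the
    mean of the squares, summation by parts against y_j^2 - y_(j+1)^2 meets
    partial sums that are nonpositive as soon as 2 j + 1 >= s, and at most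
    2 sqrt j otherwise ([slice_excess_le]).  So for every nonincreasing
    y, C/2 + gain/2 <= A E + loss, where the loss involves only decrements at j
    and values y_s with s > 2j + 1 ([core_inequality]).

    Dyadic blocks.  Let m_k = 2^k J_0.  Inside one block there is no loss, as
    y has dropped to its next level beyond 2 m_k.  The gain splits over blocks
    because a square of a sum of nonnegative terms dominates the sum of the
    squares, and by Cauchy-Schwarz block k contributes at least
    sqrt(m_k) L_k^3 / 4 ([gain_ge]).  The loss of block k is at most
    3/2 sqrt(m_k) (y_(m_k)^2 - y_(m_(k+1))^2) T_k with T_k = sum_(l>k) y_(m_l)
    ([loss_le]), hence by Young at most sqrt(m_k) (L_k^3 / 10 + 660 T_k^3).
    As nonzero blocks are 120 apart, sqrt(m_k) T_k^3 is exponentially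
    smaller than the terms of the later blocks, and its sum over the nonzero
    blocks is at most 2^(-17) times the sum of sqrt(m_k) L_k^3
    ([sparse_tail_le]).  What remains is 1/8 - 1/10 - 660/2^17 > 1/125.

    The estimates are made for finitely supported sequences
    ([finite_inequality]) and applied to the truncations max(y - y_P, 0) with
    P = m_K, which have the same decrements as y below P; then K tends to
    infinity ([limit_inequality]). *)

(** * The kernel of the cubic form *)

Definition rt {R : realType} (n : nat) : R := Num.sqrt n%:R.

(** The coefficient of y_a y_b y_(a+b) in the cubic form, when
    x_n = n^(-3/2) y_n. *)
Definition cubic_kernel {R : realType} (a b : nat) : R :=
  (a + b)%:R * (a ^ 2 + a * b + b ^ 2)%:R / (rt a * rt b * rt (a + b)) ^+ 3.

(** The part of the kernel bound left after the singular terms a^(-3/2) and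
    b^(-3/2).  Thanks to the negative term, the slice a + b = s balances to
    leading order against s^(-3/2) (y_1^2 + ... + y_s^2) when y is constant. *)
Definition excess {R : realType} (a b : nat) : R :=
  (a + b)%:R^-1 * (((rt a)^-1 + (rt b)^-1) / 2 - (rt (a + b))^-1).

Lemma rt_gt0 (R : realType) (n : nat) : (0 < n)%N -> 0 < rt n :> R.
Proof. by move=> n0; rewrite sqrtr_gt0 ltr0n. Qed.

Lemma rt_ge0 (R : realType) (n : nat) : 0 <= rt n :> R.
Proof. exact: sqrtr_ge0. Qed.

Lemma rt_sqr (R : realType) (n : nat) : rt n ^+ 2 = n%:R :> R.
Proof. by rewrite sqr_sqrtr // ler0n. Qed.

Lemma le_rt (R : realType) (m n : nat) : (m <= n)%N -> rt m <= rt n :> R.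
Proof. by move=> mn; rewrite ler_wsqrtr // ler_nat. Qed.

(** The kernel bound cleared of denominators, for p = sqrt a, q = sqrt b and
    s = sqrt (a + b).  Both sides are functions of x = p q and S = s^2, except
    for a factor s (p + q) whose square is S (S + 2 x); after squaring, the
    difference is x^3 times a cubic that is positive when S >= 2 x. *)
Lemma kernel_poly (R : realType) (p q s : R) : 0 < p -> 0 < q -> 0 < s ->
  s ^+ 2 = p ^+ 2 + q ^+ 2 ->
  p ^+ 3 * q ^+ 3 + s ^+ 2 * (p ^+ 4 + p ^+ 2 * q ^+ 2 + q ^+ 4) <=
  s ^+ 3 * (p ^+ 3 + q ^+ 3) + s * (p ^+ 2 * q ^+ 2) * (p + q) / 2.
Proof.
move=> p0 q0 s0 sE.
pose x := p * q; pose S := p ^+ 2 + q ^+ 2; pose v := s * (p + q).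
have x0 : 0 < x by exact: mulr_gt0.
have Sx : 2 * x <= S.
  have := sqr_ge0 (p - q); rewrite /S /x; lra.
have v0 : 0 < v by apply: mulr_gt0 => //; apply: addr_gt0.
have vE : v ^+ 2 = S * (S + 2 * x) by rewrite /v exprMn sE /S /x; ring.
have -> : p ^+ 3 * q ^+ 3 + s ^+ 2 * (p ^+ 4 + p ^+ 2 * q ^+ 2 + q ^+ 4)
          = S ^+ 3 - S * x ^+ 2 + x ^+ 3 by rewrite sE /S /x; ring.
have -> : s ^+ 3 * (p ^+ 3 + q ^+ 3) + s * (p ^+ 2 * q ^+ 2) * (p + q) / 2
          = v * (S ^+ 2 - S * x + x ^+ 2 / 2).
  by rewrite (exprS s 2) sE /v /S /x; field.
have S0 : 0 < S by lra.
have w0 : 0 <= S ^+ 2 - S * x + x ^+ 2 / 2.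
  have := sqr_ge0 (S - x); have := sqr_ge0 S; lra.
have L0 : 0 <= S ^+ 3 - S * x ^+ 2 + x ^+ 3.
  have : S * x ^+ 2 <= S * S ^+ 2.
    by rewrite ler_wpM2l ?(ltW S0) // ler_sqr ?nnegrE; lra.
  have := exprn_ge0 3 (ltW x0); rewrite -exprS; lra.
rewrite -ler_sqr ?nnegrE //; last by rewrite mulr_ge0 // ltW.
rewrite (exprMn _ v) vE.
have -> : S * (S + 2 * x) * (S ^+ 2 - S * x + x ^+ 2 / 2) ^+ 2 =
  (S ^+ 3 - S * x ^+ 2 + x ^+ 3) ^+ 2 +
  x ^+ 3 * (S ^+ 3 - 11 / 4 * (S ^+ 2 * x) + 5 / 2 * (S * x ^+ 2) - x ^+ 3).
  by field.
rewrite lerDl mulr_ge0 ?exprn_ge0 ?(ltW x0) //.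
(* In terms of d = S - 2 x >= 0 all coefficients of the cubic are positive. *)
have [d dE] : exists d, S = 2 * x + d by exists (S - 2 * x); ring.
have d0 : 0 <= d by lra.
rewrite dE.
have -> : (2 * x + d) ^+ 3 - 11 / 4 * ((2 * x + d) ^+ 2 * x)
   + 5 / 2 * ((2 * x + d) * x ^+ 2) - x ^+ 3
   = x ^+ 3 + 7 / 2 * (x ^+ 2 * d) + 13 / 4 * (x * d ^+ 2) + d ^+ 3 by field.
have ? := exprn_ge0 3 (ltW x0); have ? := exprn_ge0 3 d0.
have ? := mulr_ge0 (sqr_ge0 x) d0; have ? := mulr_ge0 (ltW x0) (sqr_ge0 d).
lra.
Qed.

Lemma kernel_le (R : realType) (a b : nat) : (0 < a)%N -> (0 < b)%N ->
  cubic_kernel a b <= rt a ^- 3 + rt b ^- 3 + excess a b :> R.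
Proof.
move=> a0 b0; rewrite /cubic_kernel /excess.
have -> : (a ^ 2 + a * b + b ^ 2)%:R =
    rt a ^+ 4 + rt a ^+ 2 * rt b ^+ 2 + rt b ^+ 4 :> R.
  by rewrite !(exprM _ 2 2) !rt_sqr !natrD natrM !natrX.
rewrite -!(rt_sqr R (a + b)).
have sE : rt (a + b) ^+ 2 = rt a ^+ 2 + rt b ^+ 2 :> R by rewrite !rt_sqr natrD.
have s0 : 0 < rt (a + b) :> R by rewrite rt_gt0 // addn_gt0 a0.
move: (rt a) (rt b) (rt (a + b)) (rt_gt0 R _ a0) (rt_gt0 R _ b0) s0 sE
  => p q s p0 q0 s0 sE.
have H := kernel_poly R p q s p0 q0 s0 sE.
rewrite -subr_ge0.
have -> : p ^- 3 + q ^- 3 + s ^- 2 * ((p^-1 + q^-1) / 2 - s^-1) -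
   s ^+ 2 * (p ^+ 4 + p ^+ 2 * q ^+ 2 + q ^+ 4) / (p * q * s) ^+ 3 =
  (s ^+ 3 * (p ^+ 3 + q ^+ 3) + s * (p ^+ 2 * q ^+ 2) * (p + q) / 2
   - (p ^+ 3 * q ^+ 3 + s ^+ 2 * (p ^+ 4 + p ^+ 2 * q ^+ 2 + q ^+ 4)))
   / (p * q * s) ^+ 3.
  by field; rewrite !gt_eqF.
by rewrite divr_ge0 ?subr_ge0 // exprn_ge0 // !mulr_ge0 // ltW.
Qed.

Lemma excess_ge0 (R : realType) (a b : nat) : (0 < a)%N -> (0 < b)%N ->
  0 <= excess a b :> R.
Proof.
move=> a0 b0; rewrite /excess mulr_ge0 // ?invr_ge0 ?ler0n //.
have ha : (rt (a + b))^-1 <= (rt a)^-1 :> R.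
  by rewrite lef_pV2 ?posrE ?rt_gt0 ?addn_gt0 ?a0 // le_rt // leq_addr.
have hb : (rt (a + b))^-1 <= (rt b)^-1 :> R.
  by rewrite lef_pV2 ?posrE ?rt_gt0 ?addn_gt0 ?a0 // le_rt // leq_addl.
lra.
Qed.

Lemma excessC (R : realType) (a b : nat) : excess a b = excess b a :> R.
Proof. by rewrite /excess addnC [(rt a)^-1 + _]addrC. Qed.

(** * Slices a + b = s *)

(** Square roots at half-integers: the concavity of the square root makes the
    increment of [hrt] an upper bound for half the inverse square root at the
    midpoint, which is sharper than the bound by increments of [rt]. *)
Definition hrt {R : realType} (n : nat) : R := Num.sqrt (n%:R + 2^-1).

Lemma hrt_ge0 (R : realType) (n : nat) : 0 <= hrt n :> R.
Proof. exact: sqrtr_ge0. Qed.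

Lemma hrt_sqr (R : realType) (n : nat) : hrt n ^+ 2 = n%:R + 2^-1 :> R.
Proof. by rewrite sqr_sqrtr // addr_ge0 ?ler0n ?invr_ge0. Qed.

Lemma le_of_sqr_le (R : realType) (x y : R) : 0 <= y -> x ^+ 2 <= y ^+ 2 -> x <= y.
Proof.
move=> y0 xy; have [x0|x0] := leP 0 x; last by apply: le_trans y0; exact: ltW.
by rewrite -ler_sqr ?nnegrE.
Qed.

Lemma inv_rt_le (R : realType) (n : nat) :
  (rt n.+1)^-1 <= 2 * (hrt n.+1 - hrt n) :> R.
Proof.
have t0 := rt_gt0 R n.+1 isT.
have p0 := hrt_ge0 R n.+1; have q0 := hrt_ge0 R n.
have := hrt_sqr R n.+1; have := hrt_sqr R n; have := rt_sqr R n.+1.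
move: (rt n.+1) (hrt n.+1) (hrt n) t0 p0 q0 => t p q t0 p0 q0.
rewrite -natr1 => tE qE pE.
have pq : p + q <= 2 * t.
  apply: le_of_sqr_le; first by rewrite mulr_ge0 // ltW.
  have := sqr_ge0 (p - q); rewrite exprMn; lra.
have pq0 : 0 < p - q.
  rewrite subr_gt0 -ltr_sqr ?nnegrE //; lra.
rewrite -(ler_pM2r t0) mulVf ?gt_eqF //.
have : (p + q) * (p - q) <= 2 * t * (p - q) by rewrite ler_wpM2r // ltW.
lra.
Qed.

Lemma sum_inv_rt_le (R : realType) (j : nat) :
  \sum_(1 <= a < j.+1) (rt a)^-1 <= 2 * (hrt j - hrt 0) :> R.
Proof.
elim: j => [|j IH]; first by rewrite big_geq // subrr mulr0.
rewrite big_nat_recr //=; have := inv_rt_le R j; lra.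
Qed.

Lemma sum_inv_rt_rev_le (R : realType) (s j : nat) : (j < s)%N ->
  \sum_(1 <= a < j.+1) (rt (s - a))^-1 <= 2 * (hrt s.-1 - hrt (s.-1 - j)) :> R.
Proof.
elim: j => [|j IH] js; first by rewrite big_geq // subn0 subrr mulr0.
rewrite big_nat_recr //=.
have := inv_rt_le R (s.-1 - j.+1); have -> : (s.-1 - j.+1).+1 = (s.-1 - j)%N by lia.
have -> : (s - j.+1 = s.-1 - j)%N by lia.
have := IH (ltnW js); lra.
Qed.

Lemma sum_inv_rt_le_rt (R : realType) (j : nat) :
  \sum_(1 <= a < j.+1) (rt a)^-1 <= 2 * rt j :> R.
Proof.
apply: le_trans (sum_inv_rt_le R j) _.
rewrite ler_pM2l ?ltr0n // lerBlDr.
apply: le_of_sqr_le; first by rewrite addr_ge0 ?rt_ge0 ?hrt_ge0.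
rewrite sqrrD !hrt_sqr rt_sqr.
have := mulr_ge0 (rt_ge0 R j) (hrt_ge0 R 0); lra.
Qed.

(** For j = u s the sum over a <= j is close to sqrt s times
    sqrt u + 1 - sqrt (1 - u) - 2 u, which is nonpositive for u >= 1/2 because
    sqrt u - sqrt (1 - u) = (2 u - 1) / (sqrt u + sqrt (1 - u)) and
    sqrt u + sqrt (1 - u) >= 1.  The midpoint bounds leave room for the
    discretisation. *)
Lemma half_sum_le0 (R : realType) (s j : nat) :
  (1 < s)%N -> (j < s)%N -> (s <= j.*2.+1)%N ->
  \sum_(1 <= a < j.+1)
     (((rt a)^-1 + (rt (s - a))^-1) / 2 - 2 / rt s) <= 0 :> R.
Proof.
move=> s1 js sj.
rewrite sumrB -mulr_suml big_split /= sumr_const_nat subn1 /=.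
have := sum_inv_rt_le R j; have := sum_inv_rt_rev_le R s j js.
set U := \sum_(1 <= a < j.+1) _; set V := \sum_(1 <= a < j.+1) _ => HV HU.
suff : hrt j - hrt 0 + (hrt s.-1 - hrt (s.-1 - j)) <= 2 / rt s *+ j :> R by lra.
have t0 : 0 < rt s :> R by rewrite rt_gt0 // ltnW.
rewrite -(ler_pM2r t0) -mulr_natr.
have -> : 2 / rt s * j%:R * rt s = 2 * j%:R :> R by field; rewrite gt_eqF.
have p0 := hrt_ge0 R j; have q0 := hrt_ge0 R (s.-1 - j).
have e0 := hrt_ge0 R 0; have w0 := hrt_ge0 R s.-1.
have pE := hrt_sqr R j; have qE := hrt_sqr R (s.-1 - j).
have eE := hrt_sqr R 0; have wE := hrt_sqr R s.-1; have tE := rt_sqr R s.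
have sE : s%:R = s.-1%:R + 1 :> R by rewrite natr1 prednK // ltnW.
have jE : (s.-1 - j)%:R = s.-1%:R - j%:R :> R by rewrite natrB //; lia.
have t2 : 2 <= s%:R :> R by rewrite ler_nat.
have sj' : s%:R <= 2 * j%:R + 1 :> R.
  by rewrite -natrM natr1 ler_nat mul2n.
move: (rt s) (hrt j) (hrt (s.-1 - j)) (hrt 0) (hrt s.-1) t0 p0 q0 e0 w0 pE qE eE wE tE.
move=> t p q e w t0 p0 q0 e0 w0 pE qE eE wE tE.
have pq : 0 <= p - q by rewrite subr_ge0 -ler_sqr ?nnegrE //; lra.
have tpq : t <= p + q.
  apply: le_of_sqr_le; first exact: addr_ge0.
  have := mulr_ge0 p0 q0; lra.
(* Here t <= p + q is the discrete form of sqrt u + sqrt (1 - u) >= 1. *)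
have tpq' : (p - q) * t <= (p - q) * (p + q) by rewrite ler_wpM2l.
have wt : w * t <= t ^+ 2 - 1 / 4 by have := sqr_ge0 (w - t); lra.
have te : 1 <= e * t.
  rewrite -ler_sqr ?nnegrE ?mulr_ge0 ?(ltW t0) // exprMn expr1n eE tE; lra.
lra.
Qed.

(** For a <= j < s / 2 the index s - a is the larger one, so the summand is at
    most the inverse square root of a. *)
Lemma short_sum_le (R : realType) (s j : nat) : (j.*2.+1 < s)%N ->
  \sum_(1 <= a < j.+1)
     (((rt a)^-1 + (rt (s - a))^-1) / 2 - 2 / rt s) <= 2 * rt j :> R.
Proof.
move=> js; apply: le_trans (sum_inv_rt_le_rt R j).
apply: ler_sum_nat => a /andP[a1 aj].
have t0 : 0 <= 2 / rt s :> R by rewrite mulr_ge0 // invr_ge0 rt_ge0.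
have : (rt (s - a))^-1 <= (rt a)^-1 :> R.
  rewrite lef_pV2 ?posrE ?rt_gt0 //; last lia.
  by apply: le_rt; lia.
lra.
Qed.

(** Summation by parts: writing z_a^2 as the sum of the decrements of z^2 from a
    on turns the left-hand side, minus the first term on the right, into a
    combination of the partial sums bounded in [half_sum_le0] and
    [short_sum_le].  Only decrements at j with 2 j + 1 < s survive. *)
Lemma slice_excess_le (R : realType) (z : nat -> R) (P s : nat) :
  (forall n, 0 <= z n) -> (forall m n, (m <= n)%N -> z n <= z m) ->
  z P = 0 -> (0 < s < P)%N ->
  \sum_(1 <= a < s) excess a (s - a) * z a ^+ 2 <=
  s%:R^-1 * ((rt s)^-1 * (\sum_(1 <= b < s.+1) z b ^+ 2)
    + 2 * \sum_(1 <= j < P | (j.*2.+1 < s)%N)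
             (z j ^+ 2 - z j.+1 ^+ 2) * rt j).
Proof.
move=> z0 zle zP /andP[s0 sP].
pose c a : R := ((rt a)^-1 + (rt (s - a))^-1) / 2 - 2 / rt s.
pose d j : R := z j ^+ 2 - z j.+1 ^+ 2.
have d0 j : 0 <= d j by rewrite subr_ge0 ler_sqr ?nnegrE // zle.
have zE a : (a <= P)%N -> z a ^+ 2 = \sum_(a <= j < P) d j.
  move=> aP; rewrite (telescope_sumr_eq (fun j => - z j ^+ 2)) //.
    by rewrite zP expr0n oppr0 sub0r opprK.
  by move=> j _; rewrite opprK addrC.
(* [c] is the coefficient of z_a^2 in the left-hand side minus the first term
   of the right-hand side, up to the common factor 1 / s. *)
have key : \sum_(1 <= a < s) c a * z a ^+ 2 <=
    2 * \sum_(1 <= j < P | (j.*2.+1 < s)%N) d j * rt j.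
  have -> : \sum_(1 <= a < s) c a * z a ^+ 2 =
      \sum_(1 <= a < s) \sum_(1 <= j < P | (a <= j)%N) c a * d j.
    apply: eq_big_nat => a /andP[a1 aS].
    by rewrite zE ?(ltnW (ltn_trans aS sP)) // (big_nat_widenl _ 1) // mulr_sumr.
  rewrite (exchange_big_dep_nat xpredT) //= mulr_sumr.
  rewrite [leRHS]big_mkcond /=.
  apply: ler_sum_nat => j /andP[j1 jP].
  rewrite -mulr_suml.
  have -> : \sum_(1 <= a < s | (a <= j)%N) c a =
      \sum_(1 <= a < (minn j s.-1).+1) c a.
    rewrite [RHS](big_nat_widen _ _ s); last lia.
    rewrite [LHS]big_nat_cond [RHS]big_nat_cond; apply: eq_bigl => a.
    rewrite /= ltnS leq_min; case: (leqP a j) => _ /=; lia.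
  case: ifPn => [js|]; last rewrite -leqNgt => sj.
    have -> : minn j s.-1 = j by lia.
    rewrite mulrA mulrAC; apply: ler_wpM2r => //.
    exact: short_sum_le.
  apply: mulr_le0_ge0 => //.
  have [s1|s1] := leqP s 1; last by apply: half_sum_le0; lia.
  have -> : minn j s.-1 = 0%N by lia.
  by rewrite big_geq.
have s0' : 0 < s%:R :> R by rewrite ltr0n.
have -> : \sum_(1 <= a < s) excess a (s - a) * z a ^+ 2 =
   s%:R^-1 * (\sum_(1 <= a < s) c a * z a ^+ 2 +
     (rt s)^-1 * \sum_(1 <= a < s) z a ^+ 2).
  rewrite mulr_sumr -big_split mulr_sumr; apply: eq_big_nat => a /andP[a1 aS].
  by rewrite /excess subnKC ?(ltnW aS) // /c /=; ring.
rewrite ler_pM2l ?invr_gt0 // addrC lerD //.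
rewrite ler_wpM2l ?invr_ge0 ?rt_ge0 // big_nat_recr //= lerDl sqr_ge0 //.
Qed.

(** * The inequality for an arbitrary nonincreasing sequence *)

(** 2 u (u - v) = (u - v)^2 + u^2 - v^2, and the difference between the sum of
    the z_b^2 and the sum of the z_(a+b)^2 is the sum of the first a squares. *)
Lemma shift_identity (R : realType) (z : nat -> R) (P a : nat) :
  (forall n, (P <= n)%N -> z n = 0) -> (a < P)%N ->
  2 * \sum_(1 <= b < P) z b * (z b - z (a + b)%N) =
  \sum_(1 <= b < P) (z b - z (a + b)%N) ^+ 2 + \sum_(1 <= b < a.+1) z b ^+ 2.
Proof.
move=> zP aP.
suff E : \sum_(1 <= b < P) z b ^+ 2 =
    \sum_(1 <= b < a.+1) z b ^+ 2 + \sum_(1 <= b < P) z (a + b)%N ^+ 2.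
  apply/eqP; rewrite addrC -subr_eq mulr_sumr -sumrB.
  rewrite (eq_bigr (fun b => z b ^+ 2 - z (a + b)%N ^+ 2)); last by move=> b _; ring.
  by rewrite sumrB E addrK.
rewrite (@big_cat_nat _ _ _ a.+1 1 P) //=; congr (_ + _).
have -> : \sum_(1 <= b < P) z (a + b)%N ^+ 2 =
    \sum_(a.+1 <= b < P + a) z b ^+ 2.
  rewrite -(add1n a) big_addn addnK; apply: eq_bigr => b _; by rewrite addnC.
rewrite (@big_cat_nat _ _ _ P a.+1 (P + a)) ?leq_addr //=.
rewrite [X in _ + X]big_nat_cond [X in _ + X]big1 ?addr0 // => b.
by rewrite andbT => /andP[Pb _]; rewrite zP // expr0n.
Qed.

(** The factor 1/2 in front of the squares comes from [shift_identity], whose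
    other half cancels the first term of [slice_excess_le], summed over the
    slices. *)
Lemma core_inequality (R : realType) (z : nat -> R) (P : nat) :
  (forall n, 0 <= z n) -> (forall m n, (m <= n)%N -> z n <= z m) ->
  (forall n, (P <= n)%N -> z n = 0) ->
  2^-1 * (\sum_(1 <= a < P) \sum_(1 <= b < P)
             cubic_kernel a b * z a * z b * z (a + b)%N)
  + 2^-1 * (\sum_(1 <= a < P) rt a ^- 3 * z a *
       \sum_(1 <= b < P) (z b - z (a + b)%N) ^+ 2)
  <= (\sum_(1 <= a < P) rt a ^- 3 * z a) * (\sum_(1 <= b < P) z b ^+ 2)
   + \sum_(1 <= s < P) z s / s%:R *
       \sum_(1 <= j < P | (j.*2.+1 < s)%N) (z j ^+ 2 - z j.+1 ^+ 2) * rt j.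
Proof.
move=> z0 zle zP.
set C := \sum_(1 <= a < P) _; set D := \sum_(1 <= a < P) _.
set A := \sum_(1 <= a < P) _; set E := \sum_(1 <= b < P) z b ^+ 2.
set Err := \sum_(1 <= s < P) _.
pose G := \sum_(1 <= a < P) \sum_(1 <= b < P) rt a ^- 3 * z a * z b * z (a + b)%N.
pose H := \sum_(1 <= a < P) \sum_(1 <= b < P) excess a b * z a ^+ 2 * z (a + b)%N.
pose F := \sum_(1 <= a < P) rt a ^- 3 * z a * \sum_(1 <= b < a.+1) z b ^+ 2.
have w0 a : 0 <= rt a ^- 3 :> R by rewrite invr_ge0 exprn_ge0 ?rt_ge0.
(* [G] is the contribution of one singular term, [H] that of the excess with
   z_a z_b replaced by the mean of z_a^2 and z_b^2, symmetrised, and [F] is the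
   telescoped part of the product. *)
have HC : C <= 2 * G + H.
  have GC : G = \sum_(1 <= a < P) \sum_(1 <= b < P)
      rt b ^- 3 * z a * z b * z (a + b)%N.
    rewrite exchange_big; apply: eq_bigr => a _; apply: eq_bigr => b _.
    by rewrite addnC; ring.
  have HH : H = \sum_(1 <= a < P) \sum_(1 <= b < P)
      excess a b * z b ^+ 2 * z (a + b)%N.
    rewrite exchange_big; apply: eq_bigr => a _; apply: eq_bigr => b _.
    by rewrite excessC addnC.
  have -> : 2 * G + H = G + G + 2^-1 * (H + H) by field.
  rewrite {2}GC {2}HH -!big_split mulr_sumr -big_split.
  apply: ler_sum_nat => a /andP[a1 aP]; rewrite /= -!big_split mulr_sumr -big_split.
  apply: ler_sum_nat => b /andP[b1 bP] /=.
  have -> : rt a ^- 3 * z a * z b * z (a + b)%N + rt b ^- 3 * z a * z b * z (a + b)%N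
    + 2^-1 * (excess a b * z a ^+ 2 * z (a + b)%N + excess a b * z b ^+ 2 * z (a + b)%N)
    = (rt a ^- 3 + rt b ^- 3 + excess a b) * z a * z b * z (a + b)%N
      + excess a b * z (a + b)%N * (z a - z b) ^+ 2 / 2.
    by field; rewrite !gt_eqF ?rt_gt0.
  apply: ler_wpDr.
    by rewrite divr_ge0 // mulr_ge0 ?sqr_ge0 // mulr_ge0 // excess_ge0.
  by do 3 (apply: ler_wpM2r => //); exact: kernel_le.
have HHs : H <= F + 2 * Err.
  have -> : H = \sum_(1 <= s < P) z s * \sum_(1 <= a < s) excess a (s - a) * z a ^+ 2.
    have -> : H = \sum_(1 <= a < P) \sum_(1 <= s < P | (a < s)%N)
        z s * (excess a (s - a) * z a ^+ 2).
      apply: eq_big_nat => a /andP[a1 aP].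
      transitivity (\sum_(a.+1 <= s < P) z s * (excess a (s - a) * z a ^+ 2));
        last by rewrite (big_nat_widenl _ 1).
      transitivity (\sum_(a.+1 <= s < P + a) z s * (excess a (s - a) * z a ^+ 2)).
        rewrite -(add1n a) big_addn addnK; apply: eq_bigr => b _.
        by rewrite addnK addnC; ring.
      rewrite (@big_cat_nat _ _ _ P a.+1 (P + a)) ?leq_addr //=.
      rewrite [X in _ + X]big_nat_cond [X in _ + X]big1 ?addr0 // => b.
      by rewrite andbT => /andP[Pb _]; rewrite zP // mul0r.
    rewrite (exchange_big_dep_nat xpredT) //=.
    apply: eq_big_nat => s /andP[s1 sP]; rewrite mulr_sumr.
    rewrite [RHS](big_nat_widen _ _ P) ?(ltnW sP) //.
  rewrite /F /Err mulr_sumr -big_split; apply: ler_sum_nat => s s1P /=.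
  have s0 : (0 < s)%N by case/andP: s1P.
  have slice := slice_excess_le R z P s z0 zle (zP P (leqnn P)) s1P.
  apply: le_trans (ler_wpM2l (z0 s) slice) _.
  set U := \sum_(1 <= b < s.+1) _; set V := \sum_(1 <= j < P | _) _.
  rewrite le_eqVlt; apply/orP; left; apply/eqP.
  by rewrite -!(rt_sqr R s); field; rewrite gt_eqF // rt_gt0.
have HA : 2 * (A * E - G) = D + F.
  rewrite /A mulr_suml -sumrB mulr_sumr -big_split; apply: eq_big_nat => a /andP[a1 aP].
  rewrite /= -mulrDr -(shift_identity R z P a zP aP).
  have -> : \sum_(1 <= b < P) rt a ^- 3 * z a * z b * z (a + b)%N =
    rt a ^- 3 * z a * \sum_(1 <= b < P) z b * z (a + b)%N.
    by rewrite mulr_sumr; apply: eq_bigr => b _; ring.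
  have -> : \sum_(1 <= b < P) z b * (z b - z (a + b)%N) =
      E - \sum_(1 <= b < P) z b * z (a + b)%N.
    by rewrite -sumrB; apply: eq_bigr => b _; ring.
  by ring.
lra.
Qed.

(** * Tails of a sparse sequence *)

(** At 120 the right-hand side is 2^60 and (d+1)^3 is below 2^21; from there on
    the ratio of consecutive cubes stays below sqrt 2. *)
Lemma cube_le_pow (R : realType) (d : nat) : (120 <= d)%N ->
  2 ^+ 20 * (d.+1)%:R ^+ 3 <= rt 2 ^+ d :> R.
Proof.
have s2 : rt 2 ^+ 2 = 2 :> R by rewrite rt_sqr.
have s14 : 14 / 10 <= rt 2 :> R.
  by rewrite -ler_sqr ?nnegrE ?rt_ge0 ?s2 //; lra.
elim: d => // d IH; rewrite leq_eqVlt ltnS => /orP[/eqP <-|d120].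
  rewrite (exprM _ 2 60) s2 (exprD _ 20 40) ler_wpM2l ?exprn_ge0 //.
  apply: le_trans (_ : (2 ^+ 7) ^+ 3 <= _).
    by rewrite lerXn2r ?nnegrE ?exprn_ge0 ?ler0n // -natrX ler_nat.
  by rewrite -exprM ler_weXn2l // ler1n.
have := IH d120; have : 121 <= d.+1%:R :> R by rewrite ler_nat.
rewrite -(natr1 d.+1) (exprS _ d); set c : R := 2 ^+ 20; move: (d.+1)%:R => t t121 H.
have t0 : 0 <= t by lra.
have : (t + 1) ^+ 3 <= (11 / 10 * t) ^+ 3.
  by rewrite lerXn2r ?nnegrE //; lra.
have : 14 / 10 * rt 2 ^+ d <= rt 2 * rt 2 ^+ d :> R.
  by rewrite ler_wpM2r // exprn_ge0 ?rt_ge0.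
have tc : 0 <= c * t ^+ 3 by rewrite mulr_ge0 // exprn_ge0.
rewrite exprMn => pw t3; apply: le_trans pw.
have : c * (t + 1) ^+ 3 <= c * ((11 / 10) ^+ 3 * t ^+ 3).
  by rewrite ler_wpM2l // exprn_ge0.
move: H tc; have -> : (11 / 10) ^+ 3 = 1331 / 1000 :> R by field.
lra.
Qed.

Lemma cube_add_le (R : realType) (x y : R) : 0 <= x -> 0 <= y ->
  (x + y) ^+ 3 <= 4 * (x ^+ 3 + y ^+ 3).
Proof.
move=> x0 y0.
have := mulr_ge0 (addr_ge0 x0 y0) (sqr_ge0 (x - y)); lra.
Qed.

(** Between two consecutive drops x < k of g, at distance d, the sequence is
    constant, so the tail sum at x is d g_k plus the tail sum at k, hence at
    most (d + 1) (L_k + T_k) with L_k the drop at k.  The weight at x is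
    sqrt 2 ^ d times smaller than at k, which by [cube_le_pow] beats the factor
    8 (d + 1)^3 with a margin of 2^17.  Each drop is thus charged to the next
    one. *)
Lemma sparse_tail_le (R : realType) (g : nat -> R) (K : nat) :
  (forall n, 0 <= g n) -> (forall n, g n.+1 <= g n) ->
  (forall n, (K <= n)%N -> g n = 0) ->
  (forall i j, (i < j)%N -> g i != g i.+1 -> g j != g j.+1 ->
     (120 <= j - i)%N) ->
  \sum_(0 <= k < K | g k != g k.+1) rt 2 ^+ k * (\sum_(k.+1 <= l < K) g l) ^+ 3
  <= 2 ^- 17 * \sum_(0 <= k < K) rt 2 ^+ k * (g k - g k.+1) ^+ 3.
Proof.
move=> g0 gle gK sparse.
pose T k := \sum_(k.+1 <= l < K) g l.
pose X k := \sum_(k <= i < K) rt 2 ^+ i * (g i - g i.+1) ^+ 3.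
pose W k := \sum_(k <= i < K | g i != g i.+1) rt 2 ^+ i * T i ^+ 3.
have T0 k : 0 <= T k by exact: sumr_ge0.
have s0 : 0 < rt 2 :> R by exact: rt_gt0.
have TS k : T k = g k.+1 + T k.+1.
  have [kK|kK] := ltnP k.+1 K; first by rewrite /T big_ltn.
  by rewrite /T !big_geq ?gK ?addr0 // ltnW.
have gT k : g k.+1 <= T k by rewrite TS lerDl.
have L0 k : 0 <= g k - g k.+1 by rewrite subr_ge0.
have XS k : (k < K)%N -> X k = rt 2 ^+ k * (g k - g k.+1) ^+ 3 + X k.+1.
  by move=> kK; rewrite /X big_ltn.
have WS k : (k < K)%N ->
    W k = (if g k != g k.+1 then rt 2 ^+ k * T k ^+ 3 else 0) + W k.+1.
  by move=> kK; rewrite /W big_ltn_cond //; case: ifP; rewrite ?add0r.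
(* Downward induction on k, where x is the last drop before k; the equation for
   T x records that g is constant on ]x, k].  The factor 2 leaves one copy of
   the term of x to be summed and one to absorb the term of an earlier drop. *)
have step n k x : (k + n = K)%N -> (x < k)%N -> g x != g x.+1 ->
    T x = (k - x)%:R * g k + T k ->
    2 * (rt 2 ^+ x * T x ^+ 3) + W k <= 2 ^- 17 * X k.
  elim: n k x => [|n IH] k x.
    rewrite addn0 => -> xK gx ->; rewrite gK // /W /X /T !big_geq // mulr0 addr0.
    by rewrite addr0 expr0n !mulr0.
  move=> kn xk gx Tx.
  have kK : (k < K)%N by rewrite -kn; lia.
  have kn' : (k.+1 + n = K)%N by rewrite -kn addSnnS.
  rewrite XS // WS //; case: ifPn => [gk|]; last first.
    rewrite negbK => /eqP gk; rewrite -gk subrr expr0n mulr0 !add0r.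
    apply: IH => //; first exact: ltnW.
    by rewrite Tx TS -gk subSn ?(ltnW xk) // -natr1; ring.
  have d120 := sparse _ _ xk gx gk.
  have := IH k.+1 k kn' (leqnn _) gk.
  rewrite subSnn mul1r => /(_ (TS k)) H.
  have Tx_le : T x <= (k - x).+1%:R * (g k - g k.+1 + T k).
    rewrite Tx -natr1.
    have : (k - x)%:R * g k.+1 <= (k - x)%:R * T k.
      by rewrite ler_wpM2l ?ler0n.
    have := L0 k; lra.
  have : T x ^+ 3 <= (k - x).+1%:R ^+ 3 * (4 * ((g k - g k.+1) ^+ 3 + T k ^+ 3)).
    apply: le_trans (_ : ((k - x).+1%:R * (g k - g k.+1 + T k)) ^+ 3 <= _).
      by rewrite lerXn2r ?nnegrE // mulr_ge0 ?ler0n // addr_ge0.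
    by rewrite exprMn ler_wpM2l ?exprn_ge0 ?ler0n // cube_add_le.
  set S := (g k - g k.+1) ^+ 3 + T k ^+ 3 => Tx3.
  have S0 : 0 <= S by rewrite addr_ge0 // exprn_ge0.
  have : rt 2 ^+ x * T x ^+ 3 <= 2 ^- 17 * (rt 2 ^+ k * S) / 2.
    apply: le_trans (_ : rt 2 ^+ x * ((rt 2 ^+ (k - x) / 2 ^+ 20) * (4 * S)) <= _).
      rewrite ler_wpM2l ?exprn_ge0 ?(ltW s0) //.
      apply: le_trans Tx3 _; rewrite ler_wpM2r ?mulr_ge0 //.
      by rewrite ler_pdivlMr ?exprn_gt0 // mulrC cube_le_pow.
    have -> : rt 2 ^+ k = rt 2 ^+ x * rt 2 ^+ (k - x) :> R.
      by rewrite -exprD subnKC // ltnW.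
    by rewrite le_eqVlt; apply/orP; left; apply/eqP; field.
  have : 0 <= rt 2 ^+ k * T k ^+ 3.
    by rewrite mulr_ge0 // exprn_ge0 // ltW.
  rewrite /S; set e : R := 2 ^- 17 in H *.
  have e1 : e <= 1 by rewrite invf_le1 ?exprn_gt0 // exprn_ege1 // ler1n.
  set Y := rt 2 ^+ k * T k ^+ 3 in H * => Y0 HT.
  have : e * Y <= Y by rewrite ler_piMl.
  rewrite (mulrDr (rt 2 ^+ k)) -/Y in HT; lra.
suff main n k : (k + n = K)%N -> W k <= 2 ^- 17 * X k by exact: (main K 0%N).
elim: n k => [|n IH] k kn.
  by move: kn; rewrite addn0 /W /X => ->; rewrite !big_geq // mulr0.
have kK : (k < K)%N by rewrite -kn; lia.
have kn' : (k.+1 + n = K)%N by rewrite -kn addSnnS.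
rewrite WS // XS //; case: ifPn => [gk|_].
  have := step n k.+1 k kn' (leqnn _) gk.
  rewrite subSnn mul1r => /(_ (TS k)).
  have : 0 <= rt 2 ^+ k * T k ^+ 3 by rewrite mulr_ge0 // exprn_ge0 // ltW.
  have : 0 <= rt 2 ^+ k * (g k - g k.+1) ^+ 3 by rewrite mulr_ge0 // exprn_ge0 // ltW.
  lra.
have : 0 <= rt 2 ^+ k * (g k - g k.+1) ^+ 3 by rewrite mulr_ge0 // exprn_ge0 // ltW.
have := IH k.+1 kn'; lra.
Qed.

(** * The gain of a dyadic block *)

Definition dyad (J k : nat) : nat := (2 ^ k * J)%N.

Lemma dyadS (J k : nat) : dyad J k.+1 = (2 * dyad J k)%N.
Proof. by rewrite /dyad expnS mulnA. Qed.

Lemma dyad_gt0 (J k : nat) : (0 < J)%N -> (0 < dyad J k)%N.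
Proof. by move=> J0; rewrite muln_gt0 expn_gt0. Qed.

Lemma leq_dyad (J i k : nat) : (i <= k)%N -> (dyad J i <= dyad J k)%N.
Proof. by move=> ik; rewrite leq_mul2r leq_exp2l // ik orbT. Qed.

Lemma rt_dyad (R : realType) (J k : nat) : rt (dyad J k) = rt J * rt 2 ^+ k :> R.
Proof.
elim: k => [|k IH]; first by rewrite /dyad mul1n expr0 mulr1.
by rewrite dyadS {1}/rt natrM sqrtrM // -/(rt _) -/(rt _) IH exprS mulrCA.
Qed.

Lemma dyadic_split (R : realType) (F : nat -> R) (J i K : nat) : (i <= K)%N ->
  \sum_(i <= k < K) \sum_(dyad J k <= M < dyad J k.+1) F M =
  \sum_(dyad J i <= M < dyad J K) F M.
Proof.
elim: K => [|K IH]; first by rewrite leqn0 => /eqP ->; rewrite !big_geq.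
rewrite leq_eqVlt => /orP[/eqP <-|iK]; first by rewrite !big_geq.
by rewrite big_nat_recr //= IH // -big_cat_nat ?leq_dyad.
Qed.

Lemma sum_prefix_le (R : realType) (F : nat -> R) (m n : nat) :
  (forall i, (0 < i)%N -> 0 <= F i) -> (m <= n)%N ->
  \sum_(1 <= i < m) F i <= \sum_(1 <= i < n) F i.
Proof.
move=> F0 mn; case: m mn => [|m] mn.
  rewrite [leLHS]big_geq //; rewrite big_nat_cond; apply: sumr_ge0 => i.
  by rewrite andbT => /andP[i0 _]; exact: F0.
rewrite [leRHS](@big_cat_nat _ _ _ m.+1) //= lerDl.
rewrite big_nat_cond; apply: sumr_ge0 => i.
by rewrite andbT => /andP[mi _]; apply: F0; exact: leq_trans mi.
Qed.

Lemma sum_sqr_le (R : realType) (v : nat -> R) (K : nat) : (forall k, 0 <= v k) ->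
  \sum_(0 <= k < K) v k ^+ 2 <= (\sum_(0 <= k < K) v k) ^+ 2.
Proof.
move=> v0; elim: K => [|K IH]; first by rewrite !big_geq // expr0n.
rewrite !big_nat_recr //=.
have S0 : 0 <= \sum_(0 <= k < K) v k by exact: sumr_ge0.
have := mulr_ge0 S0 (v0 K); lra.
Qed.

(** The integers b with b <= M < a + b are those of ]M - a, M]. *)
Lemma sum_shift_overlap (R : realType) (n M a : nat) : (M < n)%N -> (a <= M)%N ->
  \sum_(1 <= b < n) (b <= M < a + b)%:R = a%:R :> R.
Proof.
move=> Mn aM.
transitivity (\sum_((M - a).+1 <= b < M.+1) (1 : R)); last first.
  by rewrite sumr_const_nat subSS subKn.
rewrite [RHS](big_nat_widenl _ 1) // [RHS](big_nat_widen _ _ n) // [RHS]big_mkcond /=.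
apply: eq_bigr => b _.
have -> : (b <= M < a + b)%N = ((M - a < b) && (b < M.+1))%N by lia.
by case: ifP.
Qed.

(** A block whose total drop is L loses a L in all under a shift by a, over fewer
    than 2 m indices; Cauchy-Schwarz bounds the sum of the squares. *)
Lemma spread_ge (R : realType) (l : nat -> R) (m a : nat) : (0 < m)%N -> (a <= m)%N ->
  (a%:R * \sum_(m <= M < 2 * m) l M) ^+ 2 / (2 * m)%:R <=
  \sum_(1 <= b < 2 * m) (\sum_(m <= M < 2 * m) (b <= M < a + b)%:R * l M) ^+ 2.
Proof.
move=> m0 am.
set L := \sum_(m <= M < 2 * m) l M.
pose v b := \sum_(m <= M < 2 * m) (b <= M < a + b)%:R * l M.
have Sv : \sum_(1 <= b < 2 * m) v b = a%:R * L.
  rewrite exchange_big mulr_sumr; apply: eq_big_nat => M /andP[mM Mm].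
  by rewrite -mulr_suml sum_shift_overlap // (leq_trans am).
have m2 : 0 < (2 * m)%:R :> R by rewrite ltr0n muln_gt0.
(* Cauchy-Schwarz in the form v^2 >= 2 t v - t^2, with t the mean value of v. *)
pose t := a%:R * L / (2 * m)%:R.
apply: le_trans (_ : \sum_(1 <= b < 2 * m) (2 * t * v b - t ^+ 2) <= _); last first.
  by apply: ler_sum => b _; have := sqr_ge0 (v b - t); rewrite /v; lra.
rewrite sumrB -mulr_sumr Sv sumr_const_nat -[t ^+ 2 *+ _]mulr_natl.
have : (2 * m - 1)%:R * t ^+ 2 <= (2 * m)%:R * t ^+ 2.
  by rewrite ler_wpM2r ?sqr_ge0 // ler_nat leq_subr.
have -> : (2 * m)%:R * t ^+ 2 = (a%:R * L) ^+ 2 / (2 * m)%:R.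
  by rewrite /t; field; rewrite pnatr_eq0 -lt0n.
have -> : 2 * t * (a%:R * L) = 2 * ((a%:R * L) ^+ 2 / (2 * m)%:R).
  by rewrite /t; field; rewrite pnatr_eq0 -lt0n.
lra.
Qed.

Lemma sum_dyads_le (R : realType) (z : nat -> R) (J K a b : nat) :
  (forall m n, (m <= n)%N -> z n <= z m) ->
  \sum_(0 <= k < K) \sum_(dyad J k <= M < dyad J k.+1)
     (b <= M < a + b)%:R * (z M - z M.+1) <= z b - z (a + b)%N.
Proof.
move=> zle.
have l0 M : 0 <= z M - z M.+1 by rewrite subr_ge0 zle.
rewrite (dyadic_split R (fun M => (b <= M < a + b)%:R * (z M - z M.+1))) //.
have <- : \sum_(b <= M < a + b) (z M - z M.+1) = z b - z (a + b)%N.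
  rewrite (telescope_sumr_eq (fun M => - z M)) ?leq_addl //.
    by rewrite opprK addrC.
  by move=> M _; rewrite opprK addrC.
pose n := (dyad J K + (a + b))%N.
rewrite [leLHS](big_nat_widenl _ 0) // [leLHS](big_nat_widen _ _ n) ?leq_addr //.
rewrite [leRHS](big_nat_widenl _ 0) // [leRHS](big_nat_widen _ _ n) ?leq_addl //.
rewrite [leLHS]big_mkcond [leRHS]big_mkcond /=; apply: ler_sum => M _.
by case: (b <= M)%N; case: (M < a + b)%N; rewrite /= ?mul0r ?mul1r ?if_same //;
  case: ifP.
Qed.

Lemma sum_nat_ge (R : realType) (m : nat) :
  m%:R ^+ 2 / 2 <= \sum_(1 <= a < m.+1) a%:R :> R.
Proof.
elim: m => [|m IH]; first by rewrite big_geq // expr0n mul0r.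
rewrite big_nat_recr //= -natr1; have := ler0n R m; lra.
Qed.

(** For a <= m_k the shift by a costs block k at least (a L_k)^2 / (2 m_k), and
    y_a >= L_k; it remains to sum a^(-3/2) a^2 = sqrt a over a <= m_k, which is
    at least m_k^(3/2) / 2 since sqrt a >= a / sqrt m_k. *)
Lemma gain_ge (R : realType) (z : nat -> R) (J K : nat) :
  (0 < J)%N -> (forall n, 0 <= z n) -> (forall m n, (m <= n)%N -> z n <= z m) ->
  4^-1 * \sum_(0 <= k < K) rt (dyad J k) * (z (dyad J k) - z (dyad J k.+1)) ^+ 3 <=
  \sum_(1 <= a < dyad J K) rt a ^- 3 * z a *
    \sum_(1 <= b < dyad J K) (z b - z (a + b)%N) ^+ 2.
Proof.
move=> J0 z0 zle.
pose v k a b := \sum_(dyad J k <= M < dyad J k.+1)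
  (b <= M < a + b)%:R * (z M - z M.+1).
have v0 k a b : 0 <= v k a b.
  by apply: sumr_ge0 => M _; rewrite mulr_ge0 ?ler0n // subr_ge0 zle.
have w0 a : 0 <= rt a ^- 3 * z a by rewrite mulr_ge0 // invr_ge0 exprn_ge0 ?rt_ge0.
apply: le_trans (_ : \sum_(1 <= a < dyad J K) rt a ^- 3 * z a *
    \sum_(1 <= b < dyad J K) \sum_(0 <= k < K) v k a b ^+ 2 <= _); last first.
  apply: ler_sum => a _; apply: ler_wpM2l => //; apply: ler_sum => b _.
  apply: le_trans (sum_sqr_le R (fun k => v k a b) K _) _ => //.
  rewrite ler_sqr ?nnegrE ?sumr_ge0 // ?sum_dyads_le // subr_ge0 zle // leq_addl //.
have -> : \sum_(1 <= a < dyad J K) rt a ^- 3 * z a *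
    \sum_(1 <= b < dyad J K) \sum_(0 <= k < K) v k a b ^+ 2 =
  \sum_(0 <= k < K) \sum_(1 <= a < dyad J K) rt a ^- 3 * z a *
     \sum_(1 <= b < dyad J K) v k a b ^+ 2.
  rewrite exchange_big; apply: eq_bigr => a _ /=.
  by rewrite -mulr_sumr; congr (_ * _); rewrite exchange_big.
rewrite mulr_sumr; apply: ler_sum_nat => k /andP[_ kK].
set m := dyad J k; set L := z m - z (dyad J k.+1).
have m0 : (0 < m)%N by exact: dyad_gt0.
have LE : L = \sum_(m <= M < 2 * m) (z M - z M.+1).
  rewrite (telescope_sumr_eq (fun M => - z M)); first by rewrite opprK addrC /L dyadS.
    by rewrite mul2n -addnn leq_addr.
  by move=> M _; rewrite opprK addrC.
have L0 : 0 <= L by rewrite subr_ge0 zle // leq_dyad.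
have mK : (2 * m <= dyad J K)%N by rewrite -dyadS leq_dyad.
have r0 : 0 < rt m :> R by exact: rt_gt0.
apply: le_trans (_ : \sum_(1 <= a < m.+1) rt a ^- 3 * z a *
     \sum_(1 <= b < dyad J K) v k a b ^+ 2 <= _); last first.
  apply: sum_prefix_le => [a _|]; last by apply: leq_trans mK; lia.
  by rewrite mulr_ge0 // sumr_ge0 // => b _; exact: sqr_ge0.
apply: le_trans (_ : \sum_(1 <= a < m.+1) L ^+ 3 / (2 * m)%:R / rt m * a%:R <= _).
  rewrite -mulr_sumr.
  apply: le_trans (_ : L ^+ 3 / (2 * m)%:R / rt m * (m%:R ^+ 2 / 2) <= _); last first.
    rewrite ler_wpM2l ?sum_nat_ge //.
    by rewrite !divr_ge0 ?ler0n ?exprn_ge0 // ltW.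
  rewrite le_eqVlt natrM -(rt_sqr R m); apply/orP; left; apply/eqP.
  by field; rewrite gt_eqF.
apply: ler_sum_nat => a /andP[a0 am].
have a0' : 0 < rt a :> R by exact: rt_gt0.
have Lz : L <= z a.
  apply: le_trans (zle a m am); rewrite lerBlDr lerDl //.
apply: le_trans (_ : rt a ^- 3 * L * ((a%:R * L) ^+ 2 / (2 * m)%:R) <= _).
  have -> : rt a ^- 3 * L * ((a%:R * L) ^+ 2 / (2 * m)%:R) =
      L ^+ 3 / (2 * m)%:R * rt a.
    rewrite -(rt_sqr R a); field; rewrite pnatr_eq0 -lt0n m0 /=.
    by rewrite gt_eqF.
  rewrite -mulrA ler_wpM2l ?divr_ge0 ?exprn_ge0 ?ler0n //.
  by rewrite mulrC ler_pdivrMr // -(rt_sqr R a) expr2 ler_wpM2l ?(ltW a0') // le_rt.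
apply: ler_pM.
- by rewrite mulr_ge0 // invr_ge0 exprn_ge0 // ltW.
- by rewrite divr_ge0 ?ler0n ?sqr_ge0.
- by rewrite ler_wpM2l // invr_ge0 exprn_ge0 // ltW.
apply: le_trans (_ : \sum_(1 <= b < 2 * m) v k a b ^+ 2 <= _).
  by rewrite LE /v dyadS spread_ge.
by apply: sum_prefix_le => // b _; exact: sqr_ge0.
Qed.

(** * The loss of a dyadic block *)

(** On a dyadic block z is at most its first value and the harmonic sum is at
    most 1. *)
Lemma tail_harmonic_le (R : realType) (z : nat -> R) (J i K : nat) :
  (0 < J)%N -> (forall n, 0 <= z n) -> (forall m n, (m <= n)%N -> z n <= z m) ->
  (i <= K)%N ->
  \sum_(dyad J i <= s < dyad J K) z s / s%:R <= \sum_(i <= l < K) z (dyad J l).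
Proof.
move=> J0 z0 zle iK.
rewrite -(dyadic_split R (fun s => z s / s%:R)) //; apply: ler_sum => l _.
have m0 := dyad_gt0 J l J0.
apply: le_trans (_ : \sum_(dyad J l <= s < dyad J l.+1)
    z (dyad J l) / (dyad J l)%:R <= _).
  apply: ler_sum_nat => s /andP[ls _].
  have s0 : (0 < s)%N by exact: leq_trans ls.
  rewrite ler_pM ?invr_ge0 ?ler0n ?zle //.
  by rewrite lef_pV2 ?posrE ?ltr0n // ler_nat.
rewrite sumr_const_nat dyadS mul2n -addnn addnK -[leLHS]mulr_natr mulfVK //.
by rewrite pnatr_eq0 -lt0n.
Qed.

(** A decrement at j in block k is paired with values at s > 2 j + 1 only, that
    is beyond the end 2 m_k of the block, so each later block contributes its
    first value; and sqrt j <= 3/2 sqrt m_k inside the block. *)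
Lemma loss_le (R : realType) (z : nat -> R) (J K : nat) :
  (0 < J)%N -> (forall n, 0 <= z n) -> (forall m n, (m <= n)%N -> z n <= z m) ->
  (forall n, (n <= J)%N -> z n = z J) ->
  \sum_(1 <= s < dyad J K) z s / s%:R *
     \sum_(1 <= j < dyad J K | (j.*2.+1 < s)%N) (z j ^+ 2 - z j.+1 ^+ 2) * rt j <=
  3 / 2 * \sum_(0 <= k < K) rt (dyad J k) *
     ((z (dyad J k) ^+ 2 - z (dyad J k.+1) ^+ 2) *
        \sum_(k.+1 <= l < K) z (dyad J l)).
Proof.
move=> J0 z0 zle zJ.
set P := dyad J K.
pose d j := z j ^+ 2 - z j.+1 ^+ 2.
have d0 j : 0 <= d j by rewrite subr_ge0 ler_sqr ?nnegrE // zle.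
have zs0 s : 0 <= z s / s%:R by rewrite divr_ge0 ?ler0n.
pose G j := d j * rt j * \sum_(1 <= s < P | (j.*2.+1 < s)%N) z s / s%:R.
have G0 j : 0 <= G j.
  by rewrite !mulr_ge0 ?rt_ge0 // sumr_ge0.
have -> : \sum_(1 <= s < P) z s / s%:R *
     \sum_(1 <= j < P | (j.*2.+1 < s)%N) d j * rt j = \sum_(1 <= j < P) G j.
  under eq_bigr => s _ do rewrite mulr_sumr.
  rewrite (exchange_big_dep_nat xpredT) //=; apply: eq_bigr => j _.
  by rewrite /G mulr_sumr; apply: eq_bigr => s _; rewrite mulrC.
have JP : (J <= P)%N by rewrite -[leqLHS]mul1n leq_mul2r expn_gt0 orbT.
rewrite (@big_cat_nat _ _ _ J 1 P) //= [X in X + _]big1_seq ?add0r; last first.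
  move=> j /=; rewrite mem_index_iota => /andP[_ jJ].
  by rewrite /G /d (zJ j (ltnW jJ)) (zJ j.+1 jJ) subrr !mul0r.
have -> : \sum_(J <= j < P) G j = \sum_(dyad J 0 <= j < dyad J K) G j.
  by congr (\sum_(_ <= j < _) _); rewrite /dyad mul1n.
rewrite -dyadic_split // mulr_sumr; apply: ler_sum_nat => k /andP[_ kK].
set m := dyad J k; set T := \sum_(k.+1 <= l < K) _.
have m0 : (0 < m)%N by exact: dyad_gt0.
have T0 : 0 <= T by exact: sumr_ge0.
have -> : z m ^+ 2 - z (dyad J k.+1) ^+ 2 = \sum_(m <= j < dyad J k.+1) d j.
  rewrite (telescope_sumr_eq (fun j => - z j ^+ 2)) ?leq_dyad //.
    by rewrite opprK addrC.
  by move=> j _; rewrite opprK addrC.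
rewrite mulr_suml !mulr_sumr; apply: ler_sum_nat => j /andP[mj jm].
have -> : 3 / 2 * (rt m * (d j * T)) = d j * (3 / 2 * rt m) * T by ring.
apply: ler_pM.
- by rewrite mulr_ge0 ?rt_ge0.
- exact: sumr_ge0.
- rewrite ler_wpM2l //.
  apply: le_of_sqr_le; first by rewrite mulr_ge0 ?rt_ge0.
  rewrite exprMn !rt_sqr.
  have : j%:R <= (2 * m)%:R :> R by rewrite ler_nat -dyadS ltnW.
  have := ler0n R m; rewrite natrM; lra.
apply: le_trans (_ : \sum_(dyad J k.+1 <= s < P) z s / s%:R <= _).
  rewrite (big_nat_widenl (dyad J k.+1) 1) ?dyad_gt0 //=.
  rewrite big_mkcond [leRHS]big_mkcond; apply: ler_sum => s _ /=.
  have [js|_] := boolP (j.*2.+1 < s)%N; last by case: ifP.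
  by have -> : (dyad J k.+1 <= s)%N by rewrite dyadS; lia.
exact: tail_harmonic_le.
Qed.

(** Either T <= L / 20, and the left-hand side is a small multiple of L^3, or
    L < 20 T, and it is a multiple of T^3. *)
Lemma young_loss (R : realType) (L g T : R) : 0 <= L -> 0 <= g -> g <= T ->
  3 / 2 * (L * (L + 2 * g) * T) <= L ^+ 3 / 10 + 660 * T ^+ 3.
Proof.
move=> L0 g0 gT; have T0 : 0 <= T by exact: le_trans gT.
have : L * (L + 2 * g) * T <= L * (L + 2 * T) * T.
  by rewrite ler_wpM2r // ler_wpM2l //; lra.
have [TL|LT] := leP T (L / 20).
  have : L * (L + 2 * T) * T <= L * (L + 2 * (L / 20)) * (L / 20).
    apply: ler_pM => //; first by rewrite mulr_ge0 //; lra.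
    by rewrite ler_wpM2l //; lra.
  have := exprn_ge0 3 T0; have := exprn_ge0 3 L0; lra.
have : L * (L + 2 * T) * T <= 20 * T * (20 * T + 2 * T) * T.
  rewrite ler_wpM2r //; apply: ler_pM => //; lra.
have := exprn_ge0 3 L0; lra.
Qed.

Lemma finite_inequality (R : realType) (z : nat -> R) (J K : nat) :
  (0 < J)%N -> (forall n, 0 <= z n) -> (forall m n, (m <= n)%N -> z n <= z m) ->
  (forall n, (dyad J K <= n)%N -> z n = 0) ->
  (forall n, (n <= J)%N -> z n = z J) ->
  (forall i j, (i < j)%N -> z (dyad J i) != z (dyad J i.+1) ->
     z (dyad J j) != z (dyad J j.+1) -> (120 <= j - i)%N) ->
  2^-1 * (\sum_(1 <= a < dyad J K) \sum_(1 <= b < dyad J K)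
             cubic_kernel a b * z a * z b * z (a + b)%N)
  + rt J / 125 * (\sum_(0 <= k < K)
       rt 2 ^+ k * (z (dyad J k) - z (dyad J k.+1)) ^+ 3)
  <= (\sum_(1 <= a < dyad J K) rt a ^- 3 * z a) *
     (\sum_(1 <= b < dyad J K) z b ^+ 2).
Proof.
move=> J0 z0 zle zP zJ sparse.
pose g k := z (dyad J k).
pose T k := \sum_(k.+1 <= l < K) g l.
pose X := \sum_(0 <= k < K) rt 2 ^+ k * (g k - g k.+1) ^+ 3.
pose Y := \sum_(0 <= k < K | g k != g k.+1) rt 2 ^+ k * T k ^+ 3.
have gle k : g k.+1 <= g k by rewrite zle // leq_dyad.
have gK k : (K <= k)%N -> g k = 0 by move=> Kk; rewrite /g zP // leq_dyad.
have YX : Y <= 2 ^- 17 * X by apply: sparse_tail_le => // k; exact: z0.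
have rJ : 0 <= rt J :> R by exact: rt_ge0.
have s0 k : 0 <= rt 2 ^+ k :> R by rewrite exprn_ge0 ?rt_ge0.
have X0 : 0 <= X.
  by apply: sumr_ge0 => k _; rewrite mulr_ge0 ?exprn_ge0 ?subr_ge0 // rt_ge0.
have core := core_inequality R z (dyad J K) z0 zle zP.
have gain := gain_ge R z J K J0 z0 zle.
have loss := loss_le R z J K J0 z0 zle zJ.
have gainE : \sum_(0 <= k < K) rt (dyad J k) *
    (z (dyad J k) - z (dyad J k.+1)) ^+ 3 = rt J * X.
  by rewrite mulr_sumr; apply: eq_bigr => k _; rewrite rt_dyad mulrA.
have lossE : 3 / 2 * \sum_(0 <= k < K) rt (dyad J k) *
     ((z (dyad J k) ^+ 2 - z (dyad J k.+1) ^+ 2) *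
        \sum_(k.+1 <= l < K) z (dyad J l)) <= rt J * (X / 10 + 660 * Y).
  rewrite /X /Y [X in 660 * X]big_mkcond mulr_suml !mulr_sumr -big_split mulr_sumr.
  apply: ler_sum_nat => k /andP[_ kK] /=; rewrite rt_dyad -/(T k) -/(g k) -/(g k.+1).
  set c := rt 2 ^+ k.
  have -> : 3 / 2 * (rt J * c * ((g k ^+ 2 - g k.+1 ^+ 2) * T k)) =
    rt J * (c * (3 / 2 * ((g k - g k.+1) * ((g k - g k.+1) + 2 * g k.+1) * T k))).
    by field.
  rewrite ler_wpM2l //.
  case: ifPn => [_|/negbNE/eqP ->]; last first.
    by rewrite subrr !mul0r !mulr0 expr0n /= mulr0 mul0r addr0.
  have -> : c * (g k - g k.+1) ^+ 3 / 10 + 660 * (c * T k ^+ 3) =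
     c * ((g k - g k.+1) ^+ 3 / 10 + 660 * T k ^+ 3) by ring.
  rewrite ler_wpM2l ?s0 //; apply: young_loss => //; first by rewrite subr_ge0.
    exact: z0.
  have [k1|k1] := ltnP k.+1 K.
    by rewrite /T big_ltn // lerDl; apply: sumr_ge0 => l _; exact: z0.
  by rewrite gK //; apply: sumr_ge0 => l _; exact: z0.
move: core gain loss; rewrite gainE -/X => core gain loss.
(* The gain yields 1/8; Young and the tails cost 1/10 + 1/100, leaving more
   than 1/125. *)
have e1 : 660 * 2 ^- 17 <= 1 / 100 :> R.
  rewrite ler_pdivrMr ?exprn_gt0 //.
  have : 2 ^+ 16 <= 2 ^+ 17 :> R by rewrite ler_weXn2l // ler1n.
  have -> : 2 ^+ 17 = 2 ^+ 7 * 2 ^+ 10 :> R by rewrite -exprD.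
  have -> : 2 ^+ 7 = 128 :> R by ring.
  have -> : 2 ^+ 10 = 1024 :> R by ring.
  lra.
have : 660 * Y <= 1 / 100 * X.
  apply: le_trans (_ : 660 * (2 ^- 17 * X) <= _); first by rewrite ler_wpM2l.
  by rewrite mulrA ler_wpM2r.
move=> YX'.
have : rt J * (X / 10 + 660 * Y) <= rt J * (X * (11 / 100)).
  by rewrite ler_wpM2l //; lra.
have := mulr_ge0 rJ X0; lra.
Qed.

(** * Truncation and passage to the limit *)

(** By induction, the sum up to n is at most 3 - 2 / sqrt n. *)
Lemma sum_weight_le (R : realType) (n : nat) :
  \sum_(1 <= a < n.+1) rt a ^- 3 <= 3 :> R.
Proof.
case: n => [|n]; first by rewrite big_geq.
suff : \sum_(1 <= a < n.+2) rt a ^- 3 <= 3 - 2 / rt n.+1 :> R.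
  move/le_trans; apply; rewrite gerBl.
  by rewrite divr_ge0 // rt_ge0.
elim: n => [|n IH].
  by rewrite big_nat1 /rt sqrtr1 expr1n invr1; lra.
rewrite big_nat_recr //=; apply: le_trans (lerD IH (lexx _)) _.
have p0 := rt_gt0 R n.+1 isT; have q0 := rt_gt0 R n.+2 isT.
have : rt n.+2 ^+ 2 = rt n.+1 ^+ 2 + 1 :> R by rewrite !rt_sqr natr1.
have pq : rt n.+1 <= rt n.+2 :> R by exact: le_rt.
move: (rt n.+1) (rt n.+2) p0 q0 pq => p q p0 q0 pq E.
rewrite -subr_ge0.
have -> : 3 - 2 / q - (3 - 2 / p + q ^- 3) =
  (2 * q ^+ 2 * (q - p) - p) / (p * q ^+ 3) by field; rewrite !gt_eqF.
rewrite divr_ge0 ?mulr_ge0 ?exprn_ge0 ?(ltW p0) ?(ltW q0) //.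
have -> : 2 * q ^+ 2 * (q - p) - p = (q - p) ^+ 2 * (2 * q + p).
  have -> : 2 * q ^+ 2 * (q - p) - p =
      2 * q ^+ 2 * (q - p) - p * (q ^+ 2 - p ^+ 2) by rewrite E; ring.
  by ring.
by rewrite mulr_ge0 ?sqr_ge0 // addr_ge0 ?mulr_ge0 ?ltW.
Qed.

Lemma cvg_sum_seq (R : realType) (I : Type) (s : seq I) (f : I -> nat -> R)
    (l : I -> R) : (forall i, f i n @[n --> \oo] --> l i) ->
  \sum_(i <- s) f i n @[n --> \oo] --> \sum_(i <- s) l i.
Proof.
move=> fl; elim: s => [|i s IH].
  rewrite big_nil; under eq_cvg do rewrite big_nil; exact: cvg_cst.
by rewrite big_cons; under eq_cvg do rewrite big_cons; apply: cvgD.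
Qed.

Lemma sum_subset_le (R : realType) (I : eqType) (s t : seq I) (F : I -> R) :
  (forall i, 0 <= F i) -> uniq s -> uniq t -> {subset s <= t} ->
  \sum_(i <- s) F i <= \sum_(i <- t) F i.
Proof.
move=> F0 us ut st.
rewrite (perm_big [seq i <- t | i \in s]) /=; last first.
  apply: uniq_perm => //; first exact: filter_uniq.
  by move=> i; rewrite mem_filter; case: (boolP (i \in s)) => // /st ->.
by rewrite big_filter big_mkcond; apply: ler_sum => i _; case: ifP.
Qed.

(** The index is replaced by max(n, 1), so that the truncation is monotone and
    nonnegative at every natural number, whatever the value of y at 0. *)
Definition truncate {R : realType} (y : nat -> R) (P n : nat) : R :=
  Num.max (y n.-1.+1 - y P) 0.

Lemma truncateE (R : realType) (y : nat -> R) (P n : nat) :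
  (forall m n, (1 <= m)%N -> (m <= n)%N -> y n <= y m) ->
  (1 <= n <= P)%N -> truncate y P n = y n - y P.
Proof.
move=> y_noninc /andP[n0 nP]; rewrite /truncate prednK // max_l // subr_ge0.
exact: y_noninc.
Qed.

Lemma truncate_le (R : realType) (y : nat -> R) (P n : nat) :
  (forall n, (1 <= n)%N -> 0 <= y n) -> (1 <= n)%N -> (1 <= P)%N ->
  truncate y P n <= y n.
Proof.
move=> y_ge0 n1 P1; rewrite /truncate prednK // ge_max y_ge0 // andbT.
by rewrite lerBlDr lerDl y_ge0.
Qed.

Lemma truncate_ge0 (R : realType) (y : nat -> R) (P n : nat) : 0 <= truncate y P n.
Proof. by rewrite /truncate le_max lexx orbT. Qed.

Lemma truncated_inequality (R : realType) (y : nat -> R) (J : nat) (A E : R)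
    (K : nat) :
  (forall n, (1 <= n)%N -> 0 <= y n) ->
  (forall m n, (1 <= m)%N -> (m <= n)%N -> y n <= y m) ->
  (0 < J)%N -> (forall n, (1 <= n <= J)%N -> y n = y J) ->
  (forall i j, (i < j)%N -> y (dyad J i) != y (dyad J i.+1) ->
     y (dyad J j) != y (dyad J j.+1) -> (120 <= j - i)%N) ->
  (forall n, \sum_(1 <= a < n) rt a ^- 3 * y a <= A) ->
  (forall n, \sum_(1 <= a < n) y a ^+ 2 <= E) ->
  2^-1 * (\sum_(1 <= a < dyad J K) \sum_(1 <= b < dyad J K)
     cubic_kernel a b * truncate y (dyad J K) a * truncate y (dyad J K) b
       * truncate y (dyad J K) (a + b)%N)
  + rt J / 125 * (\sum_(0 <= k < K)
       rt 2 ^+ k * (y (dyad J k) - y (dyad J k.+1)) ^+ 3) <= A * E.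
Proof.
move=> y_ge0 y_noninc J_gt0 y_const sparse hA hE.
set P := dyad J K; pose z := truncate y P.
have P0 : (0 < P)%N by exact: dyad_gt0.
have z0 n : 0 <= z n by exact: truncate_ge0.
have JP : (J <= P)%N by rewrite -[leqLHS]mul1n leq_mul2r expn_gt0 orbT.
have -> : \sum_(0 <= k < K) rt 2 ^+ k * (y (dyad J k) - y (dyad J k.+1)) ^+ 3 =
    \sum_(0 <= k < K) rt 2 ^+ k * (z (dyad J k) - z (dyad J k.+1)) ^+ 3.
  apply: eq_big_nat => k /andP[_ kK].
  rewrite /z !truncateE ?dyad_gt0 ?leq_dyad //; last exact: ltnW.
  by congr (_ * _ ^+ 3); ring.
apply: le_trans (_ : (\sum_(1 <= a < P) rt a ^- 3 * z a) *
     (\sum_(1 <= b < P) z b ^+ 2) <= _); last first.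
  apply: ler_pM.
  - by apply: sumr_ge0 => a _; rewrite mulr_ge0 // invr_ge0 exprn_ge0 ?rt_ge0.
  - by apply: sumr_ge0 => a _; exact: sqr_ge0.
  - apply: le_trans (hA P); apply: ler_sum_nat => a /andP[a0 _].
    by rewrite ler_wpM2l ?truncate_le // invr_ge0 exprn_ge0 ?rt_ge0.
  apply: le_trans (hE P); apply: ler_sum_nat => a /andP[a0 _].
  by rewrite ler_sqr ?nnegrE ?y_ge0 ?truncate_le.
apply: finite_inequality => //.
- move=> m n mn; rewrite /z /truncate ge_max !le_max lexx orbT andbT.
  by rewrite lerD2r y_noninc //; lia.
- move=> n Pn; rewrite /z /truncate max_r // subr_le0 y_noninc //.
  by rewrite prednK // (leq_trans P0).
- move=> n nJ; have yn : y n.-1.+1 = y J by apply: y_const; lia.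
  by rewrite /z /truncate yn prednK.
- move=> i j ij zi zj; apply: sparse => //.
    by apply: contra zi => /eqP E'; rewrite /z /truncate !prednK ?dyad_gt0 // E'.
  by apply: contra zj => /eqP E'; rewrite /z /truncate !prednK ?dyad_gt0 // E'.
Qed.

(** For K large the indices occurring in the two finite sums lie below
    P = m_K, where the truncation is y - y_P; since y_P tends to 0, the finite
    inequalities pass to the limit. *)
Lemma limit_inequality (R : realType) (y : nat -> R) (J : nat) (A E : R)
    (s : seq (nat * nat)) (K0 : nat) :
  (forall n, (1 <= n)%N -> 0 <= y n) ->
  (forall m n, (1 <= m)%N -> (m <= n)%N -> y n <= y m) ->
  (0 < J)%N -> (forall n, (1 <= n <= J)%N -> y n = y J) ->
  (forall i j, (i < j)%N -> y (dyad J i) != y (dyad J i.+1) ->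
     y (dyad J j) != y (dyad J j.+1) -> (120 <= j - i)%N) ->
  y @ \oo --> (0 : R) ->
  (forall n, \sum_(1 <= a < n) rt a ^- 3 * y a <= A) ->
  (forall n, \sum_(1 <= a < n) y a ^+ 2 <= E) ->
  uniq s -> (forall p, p \in s -> (1 <= p.1)%N /\ (1 <= p.2)%N) ->
  2^-1 * (\sum_(p <- s) cubic_kernel p.1 p.2 * y p.1 * y p.2 * y (p.1 + p.2)%N)
  + rt J / 125 * (\sum_(0 <= k < K0)
       rt 2 ^+ k * (y (dyad J k) - y (dyad J k.+1)) ^+ 3) <= A * E.
Proof.
move=> y_ge0 y_noninc J_gt0 y_const sparse y0 hA hE us s1.
pose c := rt J / 125 * (\sum_(0 <= k < K0)
       rt 2 ^+ k * (y (dyad J k) - y (dyad J k.+1)) ^+ 3).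
pose e K := y (dyad J K).
have eS : e K @[K --> \oo] --> (0 : R).
  apply: (cvg_comp (dyad J) y) y0; apply/cvgnyPge => B; exists B => // n /= Bn.
  apply: leq_trans Bn _.
  by rewrite (leq_trans (ltnW (ltn_expl n (ltnSn 1)))) // leq_pmulr.
pose u K := 2^-1 * (\sum_(p <- s) cubic_kernel p.1 p.2 * (y p.1 - e K)
  * (y p.2 - e K) * (y (p.1 + p.2)%N - e K)) + c.
have ye n : y n - e K @[K --> \oo] --> y n.
  by rewrite -[X in _ --> X]subr0; apply: cvgB => //; exact: cvg_cst.
apply: (@cvgr_to_le _ \oo _ R u).
  apply: cvgD; last exact: cvg_cst.
  apply: cvgM; first exact: cvg_cst.
  apply: cvg_sum_seq => p; do 2 (apply: cvgM => //).
  by apply: cvgM => //; exact: cvg_cst.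
pose N := \max_(p <- s) (p.1 + p.2)%N.
exists (maxn K0 N) => // K /=; rewrite geq_max => /andP[K0K NK].
set P := dyad J K.
have NP p : p \in s -> (p.1 + p.2 < P)%N.
  move=> ps; have : (p.1 + p.2 <= N)%N by exact: (leq_bigmax_seq p (P := xpredT)).
  move=> /leq_trans/(_ NK) /leq_ltn_trans; apply.
  by rewrite (leq_trans (ltn_expl K (ltnSn 1))) // leq_pmulr.
apply: le_trans (truncated_inequality R y J A E K y_ge0 y_noninc J_gt0 y_const
  sparse hA hE).
have k0 a b : 0 <= cubic_kernel a b :> R.
  apply: divr_ge0; first by rewrite mulr_ge0 ?ler0n.
  by rewrite exprn_ge0 // !mulr_ge0 ?rt_ge0.
apply: lerD; last first.
  rewrite ler_wpM2l ?divr_ge0 ?rt_ge0 //.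
  rewrite [leRHS](@big_cat_nat _ _ _ K0) //= lerDl sumr_ge0 // => k _.
  rewrite mulr_ge0 ?exprn_ge0 ?rt_ge0 // subr_ge0 y_noninc ?dyad_gt0 //.
  exact: leq_dyad.
rewrite ler_wpM2l ?invr_ge0 //.
pose F (p : nat * nat) : R := cubic_kernel p.1 p.2 * truncate y P p.1 * truncate y P p.2
  * truncate y P (p.1 + p.2)%N.
have F0 p : 0 <= F p by do 3 (apply: mulr_ge0; last exact: truncate_ge0).
have -> : \sum_(1 <= a < P) \sum_(1 <= b < P)
     cubic_kernel a b * truncate y P a * truncate y P b * truncate y P (a + b)%N =
   \sum_(p <- [seq (a, b) | a <- index_iota 1 P, b <- index_iota 1 P]) F p.
  by rewrite big_allpairs.
rewrite (_ : \sum_(p <- s) _ = \sum_(p <- s) F p); last first.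
  apply: eq_big_seq => p ps; have := NP p ps; have [p1 p2] := s1 p ps => pP.
  have b1 : (1 <= p.1 <= P)%N by lia.
  have b2 : (1 <= p.2 <= P)%N by lia.
  have b3 : (1 <= p.1 + p.2 <= P)%N by lia.
  by rewrite /F !truncateE.
apply: sum_subset_le => //.
  by apply: allpairs_uniq; rewrite ?iota_uniq // => -[? ?] [? ?].
move=> [a b] ps; have := NP _ ps; have /= [p1 p2] := s1 _ ps => pP.
by apply: allpairs_f; rewrite mem_index_iota; lia.
Qed.

(** * Sums of the extended-real statement *)

Lemma blockLE (R : realType) (y : nat -> R) (J k : nat) :
  blockL y J k = y (dyad J k) - y (dyad J k.+1).
Proof.
rewrite /blockL /decrement (telescope_sumr_eq (fun M => - y M)).
- by rewrite opprK addrC.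
- exact: leq_dyad.
by move=> M _; rewrite opprK addrC.
Qed.

Lemma powR_neg_three_halves (R : realType) (n : nat) :
  n%:R `^ (- (3 / 2)) = rt n ^- 3 :> R.
Proof.
by rewrite powRN mulrC powRrM powR12_sqrt ?ler0n // powR_mulrn ?sqrtr_ge0.
Qed.

Lemma powR2_half (R : realType) (k : nat) : 2 `^ (k%:R / 2) = rt 2 ^+ k :> R.
Proof. by rewrite mulrC powRrM powR12_sqrt // powR_mulrn ?sqrtr_ge0. Qed.

Lemma positions_pred (N : option nat) (i j : nat) :
  positions N j -> (1 <= i <= j)%N -> positions N i.
Proof.
move=> [_ jN] /andP[i1 ij]; split=> //.
by case: N jN => // n jn; exact: leq_trans jn.
Qed.

Lemma gap_lt (N : option nat) (k : nat -> nat) (p q : nat) :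
  (forall j, positions N j -> positions N j.+1 -> (k j < k j.+1)%N) ->
  (forall j, positions N j -> positions N j.+1 -> (120 <= k j.+1 - k j)%N) ->
  positions N p -> positions N q -> (p < q)%N -> (120 <= k q - k p)%N.
Proof.
move=> kS gap Np; elim: q => // q IH Nq; rewrite ltnS leq_eqVlt.
move=> /orP[/eqP pq|pq]; first by subst p; exact: gap.
have Nq' : positions N q by apply: (positions_pred _ _ _ Nq); lia.
have := IH Nq' pq; have := kS q Nq' Nq; lia.
Qed.

Lemma esum_le (R : realType) (T : choiceType) (S : set T) (f : T -> R) (M : \bar R) :
  (forall s : seq T, uniq s -> (forall i, i \in s -> S i) ->
     ((\sum_(i <- s) f i)%:E <= M)%E) ->
  (\esum_(i in S) (f i)%:E <= M)%E.
Proof.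
move=> H; apply: ge_ereal_sup => _ [F [Ffin FS] <-].
rewrite fsbig_finite //= sumEFin; apply: H; first exact: fset_uniq.
by move=> i; rewrite in_fset_set // inE => /FS.
Qed.

Theorem theorem3p30 (R : realType) (y x : R^nat) (J0 : nat)
    (N : option nat) (k : nat -> nat)
    (y_ge0 : forall n : nat, (1 <= n)%N -> 0 <= y n)
    (y_noninc : forall m n : nat, (1 <= m)%N -> (m <= n)%N -> y n <= y m)
    (y_cvg0 : y @ \oo --> (0 : R))
    (J0_ge1 : (1 <= J0)%N)
    (lambda_eq0 : forall M : nat,
       (1 <= M)%N -> (M < J0)%N -> decrement y M = 0)
    (k_lists : lists_increasingly N k [set i | blockL y J0 i != 0])
    (k_gap : forall j : nat, positions N j -> positions N j.+1 ->
       (120 <= k j.+1 - k j)%N)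
    (E3_fin : (\sum_(1 <= n <oo) (y n ^+ 2)%:E < +oo)%E)
    (x_def : forall n : nat, (1 <= n)%N -> x n = n%:R `^ (- (3 / 2)) * y n) :
  ((Num.sqrt J0%:R / 125)%:E *
     (\esum_(j in positions N)
        (2 `^ ((k j)%:R / 2) * blockL y J0 (k j) ^+ 3)%:E)
   <= sumA x * E3 x - (1 / 2)%:E * cubicC x)%E
  /\ (~ (forall n : nat, (1 <= n)%N -> y n = 0) ->
      (cubicC x < 2%:E * (sumA x * E3 x))%E).
Proof.
have [kS kE] := k_lists.
have LE := blockLE R y J0.
have y_const n : (1 <= n <= J0)%N -> y n = y J0.
  move=> /andP[n1 nJ].
  have : \sum_(n <= M < J0) decrement y M = 0.
    rewrite big_nat_cond big1 // => M; rewrite andbT => /andP[nM MJ].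
    by apply: lambda_eq0 => //; exact: leq_trans nM.
  rewrite (telescope_sumr_eq (fun M => - y M)) //.
    by move/eqP; rewrite opprK addrC subr_eq0 => /eqP.
  by move=> M _; rewrite /decrement opprK addrC.
have L_pos i : y (dyad J0 i) != y (dyad J0 i.+1) ->
    exists2 j, positions N j & k j = i.
  move=> yi; have : (k @` positions N) i.
    by rewrite kE /= LE subr_eq0.
  by move=> [j Nj <-]; exists j.
have sparse i j : (i < j)%N -> y (dyad J0 i) != y (dyad J0 i.+1) ->
    y (dyad J0 j) != y (dyad J0 j.+1) -> (120 <= j - i)%N.
  move=> ij /L_pos[p Np kp] /L_pos[q Nq kq]; subst i j.
  have [pq|qp|pq] := ltngtP p q; first exact: (gap_lt N k).
    by have := gap_lt N k q p kS k_gap Nq Np qp; lia.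
  by move: ij; rewrite pq ltnn.
have xE n : (1 <= n)%N -> x n = rt n ^- 3 * y n.
  by move=> n1; rewrite x_def // powR_neg_three_halves.
have x_ge0 n : (1 <= n)%N -> 0 <= x n.
  by move=> n1; rewrite xE // mulr_ge0 ?y_ge0 // invr_ge0 exprn_ge0 ?rt_ge0.
have EE : E3 x = (\sum_(1 <= n <oo) (y n ^+ 2)%:E)%E.
  congr (limn _); apply/funext => m; apply: eq_big_nat => n /andP[n1 _].
  rewrite xE // -(rt_sqr R n); congr (_%:E); field.
  by rewrite gt_eqF // rt_gt0.
have A_fin : (sumA x < +oo)%E.
  apply: (@le_lt_trans _ _ (3 * y 1%N)%:E); last exact: ltry.
  apply: lime_le.
    by apply: is_cvg_nneseries => n n1 _; rewrite lee_fin x_ge0.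
  apply: nearW => n; rewrite sumEFin lee_fin.
  apply: le_trans (_ : (\sum_(1 <= a < n.+1) rt a ^- 3) * y 1%N <= _); last first.
    by rewrite ler_wpM2r ?y_ge0 // sum_weight_le.
  rewrite mulr_suml; apply: le_trans (_ : \sum_(1 <= a < n) rt a ^- 3 * y 1%N <= _).
    apply: ler_sum_nat => a /andP[a1 _]; rewrite xE // ler_wpM2l ?y_noninc //.
    by rewrite invr_ge0 exprn_ge0 ?rt_ge0.
  apply: sum_prefix_le => // i _.
  by rewrite mulr_ge0 ?y_ge0 // invr_ge0 exprn_ge0 ?rt_ge0.
have A_ge0 : (0 <= sumA x)%E.
  apply: le_trans (nneseries_lim_ge 1%N _).
    by rewrite big_geq.
  by move=> n n1 _; rewrite lee_fin x_ge0.
have E_ge0 : (0 <= E3 x)%E.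
  rewrite EE; apply: le_trans (nneseries_lim_ge 1%N _).
    by rewrite big_geq.
  by move=> n n1 _; rewrite lee_fin sqr_ge0.
have AF : sumA x \is a fin_num by rewrite ge0_fin_numE.
have EF : E3 x \is a fin_num by rewrite ge0_fin_numE // EE.
pose A := fine (sumA x); pose E := fine (E3 x).
have AE : (sumA x * E3 x = (A * E)%:E)%E by rewrite EFinM !fineK.
have hA n : \sum_(1 <= a < n) rt a ^- 3 * y a <= A.
  rewrite -lee_fin fineK //; apply: le_trans (nneseries_lim_ge n _).
    rewrite sumEFin lee_fin; apply: ler_sum_nat => a /andP[a1 _].
    by rewrite xE.
  by move=> a a1 _; rewrite lee_fin x_ge0.
have hE n : \sum_(1 <= a < n) y a ^+ 2 <= E.
  rewrite -lee_fin fineK // EE -sumEFin; apply: nneseries_lim_ge => a _ _.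
  by rewrite lee_fin sqr_ge0.
rewrite /cubicC AE.
set S := [set p : nat * nat | _]; set f := (fun p : nat * nat => _).
pose F i := rt 2 ^+ i * (y (dyad J0 i) - y (dyad J0 i.+1)) ^+ 3.
have d_ge0 i : 0 <= y (dyad J0 i) - y (dyad J0 i.+1).
  by rewrite subr_ge0 y_noninc ?dyad_gt0 ?leq_dyad.
have F_ge0 i : 0 <= F i by rewrite mulr_ge0 ?exprn_ge0 ?rt_ge0.
have -> : (fun j => (2 `^ ((k j)%:R / 2) * blockL y J0 (k j) ^+ 3)%:E) =
    (fun j => (F (k j))%:E).
  by apply/funext => j; rewrite powR2_half LE.
have c_gt0 : 0 < rt J0 / 125 :> R by rewrite divr_gt0 ?rt_gt0.
(* One inequality serves both claims: the lower bound is kept as a finite sum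
   while the supremum defining the cubic form is taken. *)
have key t : uniq t -> (forall j, j \in t -> positions N j) ->
    (esum S f <=
     (2 * (A * E - rt J0 / 125 * \sum_(j <- t) F (k j)))%:E)%E.
  move=> ut tN.
  apply: esum_le => s us sS; rewrite lee_fin.
  pose K0 := (\max_(j <- t) k j).+1.
  have kt : \sum_(j <- t) F (k j) <= \sum_(0 <= i < K0) F i.
    rewrite -(big_map k xpredT F); apply: sum_subset_le => //.
    - rewrite map_inj_in_uniq // => p q pt qt kpq.
      have Np := tN p pt; have Nq := tN q qt.
      have [pq|qp|//] := ltngtP p q.
        by have := gap_lt N k p q kS k_gap Np Nq pq; rewrite kpq subnn.
      by have := gap_lt N k q p kS k_gap Nq Np qp; rewrite kpq subnn.
    - exact: iota_uniq.
    move=> _ /mapP[j jt ->]; rewrite mem_index_iota /= ltnS.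
    exact: (leq_bigmax_seq j (P := xpredT)).
  have := limit_inequality R y J0 A E s K0 y_ge0 y_noninc J0_ge1 y_const sparse
    y_cvg0 hA hE us sS.
  have : rt J0 / 125 * \sum_(j <- t) F (k j) <= rt J0 / 125 * \sum_(0 <= i < K0) F i.
    by rewrite ler_wpM2l // ltW.
  rewrite -/(F _).
  have -> : \sum_(p <- s) cubic_kernel p.1 p.2 * y p.1 * y p.2 * y (p.1 + p.2)%N =
      \sum_(p <- s)
     ((p.1 + p.2)%:R * (p.1 ^ 2 + p.1 * p.2 + p.2 ^ 2)%:R
        * x p.1 * x p.2 * x (p.1 + p.2)%N).
    apply: eq_big_seq => p /sS[p1 p2].
    rewrite !xE ?addn_gt0 ?p1 // /cubic_kernel.
    by field; rewrite !gt_eqF ?rt_gt0 // addn_gt0 p1.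
  set B := \sum_(p <- s) _; lra.
have C_ge0 : (0 <= esum S f)%E.
  apply: esum_ge0 => p [p1 p2].
  by rewrite lee_fin !mulr_ge0 ?ler0n ?x_ge0 // addn_gt0 p1.
have CF : esum S f \is a fin_num.
  rewrite ge0_fin_numE //; apply: le_lt_trans (key [::] _ _) (ltry _) => //.
have key' t : uniq t -> (forall j, j \in t -> positions N j) ->
    fine (esum S f) <= 2 * (A * E - rt J0 / 125 * \sum_(j <- t) F (k j)).
  by move=> ut tN; rewrite -lee_fin fineK //; exact: key.
rewrite -(fineK CF); move: (fine _) key' => C key'; split.
  have U_le : (\esum_(j in positions N) (F (k j))%:E <=
      ((A * E - 1 / 2 * C) / (rt J0 / 125))%:E)%E.
    apply: esum_le => t ut tN; rewrite lee_fin ler_pdivlMr //.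
    by have := key' t ut tN; lra.
  have U_ge0 : (0 <= \esum_(j in positions N) (F (k j))%:E)%E.
    by apply: esum_ge0 => j _; rewrite lee_fin.
  apply: le_trans (lee_wpmul2l _ U_le) _; first by rewrite lee_fin ltW.
  rewrite -!EFinM -EFinB lee_fin /rt -/(rt J0).
  by rewrite mulrC divfK // gt_eqF.
move=> y_neq0.
(* If no block had a drop, y would be constant and hence 0. *)
have [i yi] : exists i, y (dyad J0 i) != y (dyad J0 i.+1).
  apply: contrapT => all_eq; apply: y_neq0.
  have yJ i : y (dyad J0 i) = y J0.
    elim: i => [|i IH]; first by rewrite /dyad mul1n.
    by rewrite -IH; apply/eqP/negPn/negP => yi; apply: all_eq; exists i; rewrite eq_sym.
  have yJ0 : y J0 = 0.
    apply/eqP; rewrite eq_le y_ge0 // andbT leNgt; apply/negP => yJ_gt0.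
    have [n _ yn] := cvgr_lt _ y_cvg0 _ yJ_gt0.
    have := yn (dyad J0 n); rewrite /= yJ ltxx => H.
    have // : false.
    by apply: H; rewrite (leq_trans (ltnW (ltn_expl n (ltnSn 1)))) // leq_pmulr.
  move=> n n1; have [nJ|Jn] := leqP n J0; first by rewrite y_const ?n1.
  by apply/eqP; rewrite eq_le y_ge0 // andbT -yJ0 y_noninc // ltnW.
have [j Nj kj] := L_pos i yi.
have Fi : 0 < F i.
  by rewrite mulr_gt0 ?exprn_gt0 ?rt_gt0 // lt_neqAle eq_sym subr_eq0 yi d_ge0.
rewrite -EFinM lte_fin; have := mulr_gt0 c_gt0 Fi.
have : C <= 2 * (A * E - rt J0 / 125 * F i).
  have := key' [:: j] isT; rewrite big_seq1 kj; apply => q.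
  by rewrite inE => /eqP ->.
lra.
Qed.
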